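(* Let $F:\mathcal{C}\to\mathcal{D}$ be a semiseparable functor. Then there is a unique idempotent natural transformation $e:\mathrm{Id}_{\mathcal{C}}\to\mathrm{Id}_{\mathcal{C}}$ such that $Fe=\mathrm{Id}_F$ with the following universal property: if $f,g:A\to B$ are morphisms in $\mathcal{C}$, then $Ff=Fg$ if and only if $e_B\circ f=e_B\circ g$.
   Context: For a functor $F:\mathcal{C}\to\mathcal{D}$ let $\mathcal{F}^F:\mathrm{Hom}_{\mathcal{C}}(-,-)\to\mathrm{Hom}_{\mathcal{D}}(F-,F-)$ be the natural transformation (of functors $\mathcal{C}^{\mathrm{op}}\times\mathcal{C}\to\mathsf{Set}$) with $\mathcal{F}^F_{X,Y}(f)=F(f)$. $F$ is semiseparable if there is a natural transformation $\mathcal{P}^F:\mathrm{Hom}_{\mathcal{D}}(F-,F-)\to\mathrm{Hom}_{\mathcal{C}}(-,-)$ with $\mathcal{F}^F\circ\mathcal{P}^F\circ\mathcal{F}^F=\mathcal{F}^F$. Idempotent means $e\circ e=e$; $Fe=\mathrm{Id}_F$ means $F(e_X)=\mathrm{Id}_{FX}$ for all objects $X$ of $\mathcal{C}$. *)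

(* Defs.v *)
From Stdlib Require Import FunctionalExtensionality.

Set Implicit Arguments.
Unset Strict Implicit.

Declare Scope cat_scope.
Delimit Scope cat_scope with cat.

(** Equality of objects, morphisms and natural transformations is Leibniz
    equality throughout. *)

Record category := Category {
  obj :> Type;
  Hom : obj -> obj -> Type;
  idm : forall X, Hom X X;
  compose : forall X Y Z, Hom Y Z -> Hom X Y -> Hom X Z;
  compose_id_l : forall X Y (f : Hom X Y), compose (idm Y) f = f;
  compose_id_r : forall X Y (f : Hom X Y), compose f (idm X) = f;
  compose_assoc : forall X Y Z W (h : Hom Z W) (g : Hom Y Z) (f : Hom X Y),
    compose h (compose g f) = compose (compose h g) f
}.
Arguments Hom {c} X Y.
Arguments idm {c} X.
Arguments compose {c X Y Z} g f : rename.

Notation "g ∘ f" := (compose g f) (at level 40, left associativity) : cat_scope.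
Open Scope cat_scope.

Record functor (C D : category) := Functor {
  fobj :> C -> D;
  fmap : forall X Y : C, Hom X Y -> Hom (fobj X) (fobj Y);
  fmap_id : forall X : C, fmap (idm X) = idm (fobj X);
  fmap_compose : forall (X Y Z : C) (g : Hom Y Z) (f : Hom X Y),
    fmap (g ∘ f) = fmap g ∘ fmap f
}.
Arguments fmap {C D} F {X Y} f : rename.

Record nat_trans (C D : category) (F G : functor C D) := NatTrans {
  component :> forall X : C, Hom (F X) (G X);
  naturality : forall (X Y : C) (f : Hom X Y),
    component Y ∘ fmap F f = fmap G f ∘ component X
}.

#[local] Obligation Tactic := simpl; intros; try reflexivity.

Program Definition id_functor (C : category) : functor C C :=
  {| fobj := fun X => X; fmap := fun X Y f => f |}.

Program Definition comp_functor (C D E : category)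
    (G : functor D E) (F : functor C D) : functor C E :=
  {| fobj := fun X => G (F X); fmap := fun X Y f => fmap G (fmap F f) |}.
Next Obligation. now rewrite !fmap_id. Qed.
Next Obligation. now rewrite !fmap_compose. Qed.

Program Definition nt_comp (C D : category) (F G H : functor C D)
    (b : nat_trans G H) (a : nat_trans F G) : nat_trans F H :=
  {| component := fun X => b X ∘ a X |}.
Next Obligation.
  now rewrite <- compose_assoc, naturality, compose_assoc, naturality,
    <- compose_assoc.
Qed.

Program Definition op (C : category) : category :=
  {| obj := C;
     Hom := fun X Y => @Hom C Y X;
     idm := fun X => @idm C X;
     compose := fun X Y Z g f => @compose C Z Y X f g |}.
Next Obligation. apply compose_id_r. Qed.
Next Obligation. apply compose_id_l. Qed.
Next Obligation. symmetry; apply compose_assoc. Qed.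

Program Definition prod_cat (C D : category) : category :=
  {| obj := C * D;
     Hom := fun X Y => (Hom (fst X) (fst Y) * Hom (snd X) (snd Y))%type;
     idm := fun X => (idm (fst X), idm (snd X));
     compose := fun X Y Z g f => (fst g ∘ fst f, snd g ∘ snd f) |}.
Next Obligation. now destruct f; simpl; rewrite !compose_id_l. Qed.
Next Obligation. now destruct f; simpl; rewrite !compose_id_r. Qed.
Next Obligation. now rewrite !compose_assoc. Qed.

(** The category of sets, with [Type] in the role of the universe of sets. *)
Program Definition type_cat : category :=
  {| obj := Type;
     Hom := fun A B => A -> B;
     idm := fun A x => x;
     compose := fun A B C g f x => g (f x) |}.

Program Definition op_functor (C D : category) (F : functor C D) :
    functor (op C) (op D) :=
  {| fobj := fun X : op C => F X : op D;
     fmap := fun X Y f => @fmap C D F Y X f |}.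
Next Obligation. apply fmap_id. Qed.
Next Obligation. apply fmap_compose. Qed.

Program Definition prod_functor (C C' D D' : category)
    (F : functor C D) (G : functor C' D') :
    functor (prod_cat C C') (prod_cat D D') :=
  {| fobj := fun X : prod_cat C C' => (F (fst X), G (snd X)) : prod_cat D D';
     fmap := fun X Y f => (fmap F (fst f), fmap G (snd f)) |}.
Next Obligation. now rewrite !fmap_id. Qed.
Next Obligation. now rewrite !fmap_compose. Qed.

Program Definition hom_functor (C : category) :
    functor (prod_cat (op C) C) type_cat :=
  {| fobj := fun X : prod_cat (op C) C => @Hom C (fst X) (snd X) : type_cat;
     fmap := fun X Y f (h : @Hom C (fst X) (snd X)) =>
       snd f ∘ h ∘ (fst f : @Hom C (fst Y) (fst X)) |}.
Next Obligation.
  apply functional_extensionality; intro h; simpl.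
  now rewrite compose_id_l, compose_id_r.
Qed.
Next Obligation.
  apply functional_extensionality; intro h; simpl.
  now rewrite !compose_assoc.
Qed.

(** Hom_D(F-, F-) as a functor on C^op x C. *)
Definition hom_functor_along (C D : category) (F : functor C D) :
    functor (prod_cat (op C) C) type_cat :=
  comp_functor (hom_functor D) (prod_functor (op_functor F) F).

Program Definition hom_map (C D : category) (F : functor C D) :
    nat_trans (hom_functor C) (hom_functor_along F) :=
  {| component := fun X (f : @Hom C (fst X) (snd X)) => fmap F f |}.
Next Obligation.
  apply functional_extensionality; intro h; simpl.
  now rewrite !fmap_compose.
Qed.

Definition semiseparable (C D : category) (F : functor C D) : Prop :=
  exists P : nat_trans (hom_functor_along F) (hom_functor C),
    nt_comp (hom_map F) (nt_comp P (hom_map F)) = hom_map F.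

Definition idempotent_nt (C D : category) (F : functor C D)
    (e : nat_trans F F) : Prop :=
  nt_comp e e = e.

(* Main.v *)
(** Put [e_X = P(id_{FX})].  Naturality of [P] in both variables gives
    [e ∘ f = P(F f) = f ∘ e], and [F P F = F] at the identity gives
    [F e = id]; hence [e ∘ f] depends only on [F f].  If [e] and [e'] both have
    the stated properties, then [F e = id = F e'] yields [e' ∘ e = e'] and
    [e ∘ e' = e], while [e] and [e'] commute by naturality. *)

Require Import Defs.
From Stdlib Require Import FunctionalExtensionality ProofIrrelevance.

(** Naturality proofs are identified by proof irrelevance, so only the components matter. *)
Lemma nat_trans_ext (C D : category) (F G : functor C D) (a b : nat_trans F G) :
  (forall X : C, a X = b X) -> a = b.
Proof.
  destruct a as [a Ha], b as [b Hb]; simpl; intro H.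
  apply functional_extensionality_dep in H; subst b.
  now rewrite (proof_irrelevance _ Ha Hb).
Qed.

Section HomSection.

Variables (C D : category) (F : functor C D).
Variable P : nat_trans (hom_functor_along F) (hom_functor C).

Definition hom_section (A B : C) (h : Hom (F A) (F B)) : Hom A B := P (A, B) h.

(** The naturality square of [P] at [(u, v)], evaluated at [h]; [u] runs backwards because the first
    variable is contravariant. *)
Lemma hom_section_natural (A A' B B' : C) (u : Hom A' A) (v : Hom B B')
    (h : Hom (F A) (F B)) :
  hom_section A' B' (fmap F v ∘ h ∘ fmap F u) = v ∘ hom_section A B h ∘ u.
Proof.
  exact (equal_f (@naturality _ _ _ _ P (A, B) (A', B') (u, v)) h).
Qed.

Lemma fmap_hom_section (A B : C) (f : Hom A B) :
  nt_comp (hom_map F) (nt_comp P (hom_map F)) = hom_map F ->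
  fmap F (hom_section A B (fmap F f)) = fmap F f.
Proof.
  intro H.
  exact (equal_f (f_equal
    (fun t : nat_trans (hom_functor C) (hom_functor_along F) => t (A, B)) H) f).
Qed.

Lemma section_id_compose (A B : C) (f : Hom A B) :
  hom_section B B (idm (F B)) ∘ f = hom_section A B (fmap F f).
Proof.
  (* Padding with an identity on the left exposes the naturality pattern with [u = f] and [v] an
     identity. *)
  rewrite <- (compose_id_l (hom_section B B _)), <- hom_section_natural.
  now rewrite fmap_id, !compose_id_l.
Qed.

Lemma compose_section_id (A B : C) (f : Hom A B) :
  f ∘ hom_section A A (idm (F A)) = hom_section A B (fmap F f).
Proof.
  rewrite <- (compose_id_r (f ∘ _)), <- hom_section_natural.
  now rewrite fmap_id, !compose_id_r.
Qed.

Definition section_id : nat_trans (id_functor C) (id_functor C) :=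
  @NatTrans C C (id_functor C) (id_functor C)
    (fun X => hom_section X X (idm (F X)))
    (fun A B f => eq_trans (section_id_compose A B f)
                           (eq_sym (compose_section_id A B f))).

End HomSection.

Theorem proposition1p4 (C D : category) (F : functor C D)
    (hF : semiseparable F) :
  exists! e : nat_trans (id_functor C) (id_functor C),
    idempotent_nt e /\
    (forall X : C, fmap F (e X) = idm (F X)) /\
    (forall (A B : C) (f g : Hom A B),
       fmap F f = fmap F g <-> (e B ∘ f = e B ∘ g)%cat).
Proof.
  destruct hF as [P HP].
  assert (He : forall X : C, fmap F (section_id _ _ F P X) = idm (F X)).
  { intro X; simpl; rewrite <- fmap_id; now apply fmap_hom_section. }
  assert (Hu : forall (A B : C) (f g : Hom A B), fmap F f = fmap F g <->
    section_id _ _ F P B ∘ f = section_id _ _ F P B ∘ g).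
  { intros A B f g; split; intro H.
    - simpl; rewrite !section_id_compose; now rewrite H.
    (* Applying [F] turns the factor at [B] into an identity, which cancels. *)
    - apply (f_equal (fun h => fmap F h)) in H.
      rewrite !fmap_compose in H.
      rewrite !He, !compose_id_l in H; exact H. }
  exists (section_id _ _ F P); split; [split; [| split]; trivial |].
  - apply nat_trans_ext; intro X; simpl.
    (* The composite becomes [P] applied to [F e_X], which is the identity of [F X]. *)
    rewrite section_id_compose.
    now f_equal; apply He.
  - intros e' [_ [He' Hu']]; apply nat_trans_ext; intro X.
    assert (H1 : e' X ∘ section_id _ _ F P X = e' X).
    { refine (eq_trans _ (compose_id_r (e' X))).
      (* [F] sends both [e_X] and the identity of [X] to the identity, so postcomposing with [e' X]
         identifies them. *)
      apply Hu'; rewrite fmap_id; apply He. }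
    assert (H2 : section_id _ _ F P X ∘ e' X = section_id _ _ F P X).
    { refine (eq_trans _ (compose_id_r (section_id _ _ F P X))).
      apply Hu; rewrite fmap_id; apply He'. }
    rewrite <- H1; refine (eq_trans (eq_sym H2) _).
    (* Naturality of [e'] at the endomorphism [e_X] gives the commutation. *)
    symmetry; exact (naturality e' (section_id _ _ F P X)).
Qed.
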